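(* Suppose each $f_i$ is strongly convex with constant $\mu_i>0$ and differentiable, $i=1,\dots,m$. Suppose the optimal values of the primal problem (P) and the dual problem (D) are attained, at $\mathbf{y}^\star$ and $\boldsymbol{\lambda}^\star$ respectively, and strong duality $f(\mathbf{y}^\star)=g(\boldsymbol{\lambda}^\star)$ holds. Let $\mu=\min_i\mu_i$, $S=\sqrt{(4+4\cos(\pi/m))/\mu}$, and for $\boldsymbol{\lambda}\in\mathbb{R}^{n(m-1)}$ let $$\mathbf{y}(\boldsymbol{\lambda})=\arg\min_{\mathbf{y}\in\bar{\mathcal{Y}}}\left(f(\mathbf{y})+\boldsymbol{\lambda}^{T}\mathbf{A}\mathbf{y}\right).$$ Then for all $\boldsymbol{\lambda}\in\mathbb{R}^{n(m-1)}$: 1. $g(\boldsymbol{\lambda}^\star)-g(\boldsymbol{\lambda})\ge\frac{\mu}{2}\|\mathbf{y}(\boldsymbol{\lambda})-\mathbf{y}^\star\|^2$. 2. $g(\boldsymbol{\lambda}^\star)-g(\boldsymbol{\lambda})+S\,\|\boldsymbol{\lambda}\|\sqrt{g(\boldsymbol{\lambda}^\star)-g(\boldsymbol{\lambda})}\ge|f(\mathbf{y}(\boldsymbol{\lambda}))-f(\mathbf{y}^\star)|$.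
   Context: Let $m\ge2$, $n\ge1$ be integers, $\mathcal{Y}\subseteq\mathbb{R}^n$ a closed convex set, and $f_i:\mathbb{R}^n\to\mathbb{R}$, $i=1,\dots,m$, strictly convex closed functions. For $\mathbf{y}=(\mathbf{y}_1,\dots,\mathbf{y}_m)\in(\mathbb{R}^n)^m=\mathbb{R}^{nm}$ put $f(\mathbf{y})=\sum_{i=1}^m f_i(\mathbf{y}_i)$, let $\bar{\mathcal{Y}}=\mathcal{Y}^m$, and $\mathbf{A}\mathbf{y}=(\mathbf{y}_1-\mathbf{y}_2,\dots,\mathbf{y}_{m-1}-\mathbf{y}_m)\in\mathbb{R}^{n(m-1)}$. Primal problem (P): minimize $f(\mathbf{y})$ subject to $\mathbf{y}\in\bar{\mathcal{Y}}$, $\mathbf{A}\mathbf{y}=\mathbf{0}$. Dual function: $g(\boldsymbol{\lambda})=\inf_{\mathbf{y}\in\bar{\mathcal{Y}}}\big[f(\mathbf{y})+\boldsymbol{\lambda}^{T}\mathbf{A}\mathbf{y}\big]$. Dual problem (D): maximize $g(\boldsymbol{\lambda})$ over $\boldsymbol{\lambda}\in\mathbb{R}^{n(m-1)}$. Norms are Euclidean. A function $\varphi$ is strongly convex with constant $\sigma>0$ if $\varphi-\frac{\sigma}{2}\|\cdot\|^2$ is convex. *)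

(* Defs.v *)
(* MathComp-Analysis, over an arbitrary [R : realType]. *)
From mathcomp Require Import all_boot all_order all_algebra.
From mathcomp Require Import all_classical all_reals all_analysis.

Set Implicit Arguments.
Unset Strict Implicit.
Unset Printing Implicit Defensive.

Import Order.TTheory GRing.Theory Num.Theory.
Import numFieldNormedType.Exports.

Local Open Scope classical_set_scope.
Local Open Scope ring_scope.

(* The library norm on matrices is the sup norm, hence the Euclidean structure
   below. A point of (R^n)^m is an m x n matrix whose i-th row is its i-th
   block; under (R^n)^m = R^(nm), [edot] and [enorm] are the usual scalar
   product and Euclidean norm of R^(nm). *)
Definition edot {R : realType} {p q : nat} (x y : 'M[R]_(p, q)) : R :=
  \sum_i \sum_j x i j * y i j.

Definition enorm {R : realType} {p q : nat} (x : 'M[R]_(p, q)) : R :=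
  Num.sqrt (edot x x).

Definition strictly_convex {R : realType} {n : nat} (phi : 'rV[R]_n -> R) :=
  forall (x y : 'rV[R]_n) (t : R), x != y -> 0 < t -> t < 1 ->
    phi (t *: x + (1 - t) *: y) < t * phi x + (1 - t) * phi y.

(* Closedness in the sense of convex analysis: the epigraph is closed. *)
Definition closed_function {R : realType} {n : nat} (phi : 'rV[R]_n -> R) :=
  closed [set p : 'rV[R]_n * R | phi p.1 <= p.2].

Definition strongly_convex {R : realType} {n : nat} (sigma : R)
    (phi : 'rV[R]_n -> R) :=
  @convex_function R 'rV[R]_n setT
    (fun x : 'rV[R]_n => phi x - sigma / 2 * enorm x ^+ 2).

Definition argmin {R : realType} {T : Type} (D : set T) (F : T -> R) : set T :=
  [set x | D x /\ forall z, D z -> F x <= F z].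

Definition fst_ord {m : nat} (i : 'I_m.-1) : 'I_m := widen_ord (leq_pred m) i.

Lemma snd_ord_subproof (m : nat) (i : 'I_m.-1) : (i.+1 < m)%N.
Proof. by rewrite -ltn_predRL. Qed.

Definition snd_ord {m : nat} (i : 'I_m.-1) : 'I_m :=
  Ordinal (snd_ord_subproof i).

(* A y = (y_1 - y_2, ..., y_(m-1) - y_m) *)
Definition diff_op {R : realType} {m n : nat} (y : 'M[R]_(m, n)) :
    'M[R]_(m.-1, n) :=
  \matrix_(i < m.-1) (row (fst_ord i) y - row (snd_ord i) y).

Definition objective {R : realType} {m n : nat} (f : 'I_m -> 'rV[R]_n -> R)
    (y : 'M[R]_(m, n)) : R :=
  \sum_(i < m) f i (row i y).

Definition setpow {R : realType} {m n : nat} (Y : set 'rV[R]_n) :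
    set 'M[R]_(m, n) :=
  [set y | forall i, Y (row i y)].

Definition primal_optimal {R : realType} {m n : nat} (Y : set 'rV[R]_n)
    (f : 'I_m -> 'rV[R]_n -> R) : set 'M[R]_(m, n) :=
  argmin (setpow Y `&` [set y | diff_op y = 0]) (objective f).

Definition lagrangian {R : realType} {m n : nat} (f : 'I_m -> 'rV[R]_n -> R)
    (lam : 'M[R]_(m.-1, n)) (y : 'M[R]_(m, n)) : R :=
  objective f y + edot lam (diff_op y).

(* An infimum in the extended reals, a priori possibly infinite. *)
Definition dual_function {R : realType} {m n : nat} (Y : set 'rV[R]_n)
    (f : 'I_m -> 'rV[R]_n -> R) (lam : 'M[R]_(m.-1, n)) : \bar R :=
  ereal_inf [set (lagrangian f lam y)%:E | y in setpow Y].

Definition dual_optimal {R : realType} {m n : nat} (Y : set 'rV[R]_n)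
    (f : 'I_m -> 'rV[R]_n -> R) : set 'M[R]_(m.-1, n) :=
  [set lam | forall lam', (dual_function Y f lam' <= dual_function Y f lam)%E].

(* y(lam), picked in the set of minimizers; the default value 0 is used only if
   that set is empty. *)
Definition lagrangian_min {R : realType} {m n : nat} (Y : set 'rV[R]_n)
    (f : 'I_m -> 'rV[R]_n -> R) (lam : 'M[R]_(m.-1, n)) : 'M[R]_(m, n) :=
  xget 0 (argmin (setpow Y) (lagrangian f lam)).

(* Main.v *)
(* For fixed [lam] the Lagrangian is strongly convex with constant [mu], so it has
   a unique minimizer y(lam) over Y^m and grows quadratically away from it.
   Evaluated at the feasible point [ystar], where the Lagrangian equals
   f(ystar) = g(lamstar), this growth is the first inequality. For the second,
   f(y(lam)) - f(ystar) = g(lam) - g(lamstar) - lam^T A y(lam), with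
   A y(lam) = A (y(lam) - ystar); Cauchy-Schwarz, the first inequality, and
   the bound 2 + 2 cos (pi / m) on the squared operator norm of A (the largest
   Laplacian eigenvalue of a path) conclude. *)
Require Import Defs.
From mathcomp Require Import all_boot all_order all_algebra.
From mathcomp Require Import all_classical all_reals all_analysis.
From mathcomp Require Import ring lra.
Import Order.TTheory GRing.Theory Num.Theory.
Import numFieldNormedType.Exports.
Local Open Scope classical_set_scope.
Local Open Scope ring_scope.

Lemma sqr_sub_le_weighted (R : realFieldType) (a b x y : R) :
  0 < a -> 0 < b ->
  (x - y) ^+ 2 <= (1 + b / a) * x ^+ 2 + (1 + a / b) * y ^+ 2.
Proof.
move=> a0 b0; rewrite -subr_ge0.
have -> : (1 + b / a) * x ^+ 2 + (1 + a / b) * y ^+ 2 - (x - y) ^+ 2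
    = (b * x + a * y) ^+ 2 / (a * b).
  by field; rewrite !gt_eqF.
by rewrite divr_ge0 ?sqr_ge0 ?mulr_ge0 ?ltW.
Qed.

(* [v] is, up to the alternating sign (-1)^k, the eigenvector of the Laplacian of
   the path for its largest eigenvalue. Weighting the k-th difference by the ratio
   of consecutive entries of [v] makes the weights on each [x k] add up to that
   eigenvalue. *)
Lemma path_diff_le (R : realType) (m : nat) (x : nat -> R) :
  \sum_(i < m) (x i - x i.+1) ^+ 2
  <= (2 + 2 * cos (pi / m.+1%:R)) * \sum_(i < m.+1) x i ^+ 2.
Proof.
set th : R := pi / m.+1%:R; set c := cos th.
have m0 : 0 < m.+1%:R :> R by rewrite ltr0n.
have mth : m.+1%:R * th = pi by rewrite /th mulrC divfK// gt_eqF.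
have th0 : 0 < th by rewrite divr_gt0// pi_gt0.
pose v k : R := sin ((2 * k%:R + 1) * (th / 2)).
have vgt0 k : (k < m.+1)%N -> 0 < v k.
  move=> km; apply: sin_gt0_pi; rewrite -mth.
  apply/andP; split; first by have := ler0n R k; move=> k0; apply: mulr_gt0; lra.
  have -> : (2 * k%:R + 1) * (th / 2) = (k%:R + 1 / 2) * th by field.
  rewrite ltr_pM2r//; move: km; rewrite -(ler_nat R) -[k.+1%:R]natr1; lra.
have vrec k : v k.+2 + v k = 2 * c * v k.+1.
  rewrite /v -[k.+2%:R]natr1 -[k.+1%:R]natr1.
  set a := (2 * (k%:R + 1) + 1) * (th / 2).
  have -> : (2 * (k%:R + 1 + 1) + 1) * (th / 2) = a + th by rewrite /a; field.
  have -> : (2 * k%:R + 1) * (th / 2) = a - th by rewrite /a; field.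
  by rewrite sinD sinB -/c; ring.
have v1 : v 1%N = (1 + 2 * c) * v 0%N.
  rewrite /v mulr0 add0r mul1r.
  have -> : (2 * 1 + 1) * (th / 2) = th / 2 + th by field.
  have : sin (th / 2 - th) = - sin (th / 2).
    by rewrite -sinN; congr sin; field.
  by rewrite sinB sinD -/c; lra.
have vm : v m.+1 = - v m.
  rewrite /v.
  have -> : (2 * m.+1%:R + 1) * (th / 2) = th / 2 + pi.
    by rewrite -mth -[m.+1%:R]natr1; field.
  have -> : (2 * m%:R + 1) * (th / 2) = - (th / 2 - pi).
    by rewrite -mth -[m.+1%:R]natr1; field.
  by rewrite sinN sinDpi sinB cospi sinpi; ring.
suff H k : (k < m.+1)%N ->
    \sum_(i < k) (x i - x i.+1) ^+ 2
    <= (2 + 2 * c) * \sum_(i < k) x i ^+ 2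
       + (1 + 2 * c - v k.+1 / v k) * x k ^+ 2.
  apply: le_trans (H m _) _ => //.
  have /gt_eqF/negbT vm0 := vgt0 m (ltnSn m).
  by rewrite vm mulNr divff// big_ord_recr/=; lra.
elim: k => [|k IH] km.
  rewrite !big_ord0 v1 mulfK ?gt_eqF ?vgt0// ; lra.
have km' := ltnW km.
rewrite !big_ord_recr/=.
have := sqr_sub_le_weighted _ _ _ (x k) (x k.+1) (vgt0 _ km') (vgt0 _ km).
have -> : v k.+2 / v k.+1 = 2 * c - v k / v k.+1.
  have -> : v k.+2 = 2 * c * v k.+1 - v k by rewrite -vrec addrK.
  by field; rewrite gt_eqF// vgt0.
by move: (IH km'); lra.
Qed.

Section euclid.
Context {R : realType} {p q : nat}.
Implicit Types x y z : 'M[R]_(p, q).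

Lemma edot_ge0 x : 0 <= edot x x.
Proof.
by apply: sumr_ge0 => i _; apply: sumr_ge0 => j _; rewrite -expr2 sqr_ge0.
Qed.

Lemma sqr_enorm x : enorm x ^+ 2 = edot x x.
Proof. by rewrite sqr_sqrtr// edot_ge0. Qed.

Lemma enorm_ge0 x : 0 <= enorm x.
Proof. exact: sqrtr_ge0. Qed.

Lemma edotDZ (a b : R) z x y :
  edot z (a *: x + b *: y) = a * edot z x + b * edot z y.
Proof.
rewrite /edot !mulr_sumr -big_split; apply: eq_bigr => i _ /=.
rewrite !mulr_sumr -big_split; apply: eq_bigr => j _ /=.
by rewrite !mxE; ring.
Qed.

Lemma edotC x y : edot x y = edot y x.
Proof. by do 2 (apply: eq_bigr => ? _); rewrite mulrC. Qed.

Lemma edotDZl (a b : R) x y z :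
  edot (a *: x + b *: y) z = a * edot x z + b * edot y z.
Proof. by rewrite edotC edotDZ !(edotC z). Qed.

Lemma edotB x y : edot (x - y) (x - y) = edot x x - 2 * edot x y + edot y y.
Proof.
have -> : x - y = 1 *: x + (-1) *: y by rewrite scale1r scaleN1r.
rewrite edotDZl !edotDZ (edotC y x); ring.
Qed.

Lemma enorm_eq0 x : enorm x = 0 -> x = 0.
Proof.
move=> x0; have := sqr_enorm x; rewrite x0 expr0n/= => /esym/eqP.
rewrite psumr_eq0 => [/allP H|i _]; last first.
  by apply: sumr_ge0 => j _; rewrite -expr2 sqr_ge0.
apply/matrixP => i j; rewrite mxE; have := H i (mem_index_enum i).
rewrite /= psumr_eq0 => [/allP/(_ j (mem_index_enum j))|k _].
  by rewrite /= mulf_eq0 orbb => /eqP.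
by rewrite -expr2 sqr_ge0.
Qed.

Lemma edot_le x y : `|edot x y| <= enorm x * enorm y.
Proof.
have [|y0] := leP (edot y y) 0.
  rewrite -sqr_enorm => y0.
  have -> : y = 0.
    by apply: enorm_eq0; apply/eqP; rewrite -sqrf_eq0 eq_le y0 sqr_ge0.
  have -> : edot x 0 = 0.
    by apply: big1 => i _; apply: big1 => j _; rewrite mxE mulr0.
  by rewrite normr0 mulr_ge0 ?enorm_ge0.
rewrite -ler_sqr ?nnegrE ?mulr_ge0 ?enorm_ge0// exprMn !sqr_enorm.
rewrite real_normK ?num_real//.
have := edot_ge0 (edot y y *: x + (- edot x y) *: y).
rewrite edotDZl !edotDZ (edotC y x).
have -> : edot y y * (edot y y * edot x x + - edot x y * edot x y) +
   - edot x y * (edot y y * edot x y + - edot x y * edot y y) =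
   edot y y * (edot x x * edot y y - edot x y ^+ 2) by ring.
by rewrite pmulr_rge0// subr_ge0.
Qed.

Lemma mx_norm_le_enorm x : `|x| <= enorm x.
Proof.
rewrite {1}/Num.norm /= mx_normrE; apply/bigmax_leP; split.
  exact: enorm_ge0.
case=> i j _ /=; rewrite -ler_sqr ?nnegrE ?enorm_ge0// real_normK ?num_real//.
rewrite sqr_enorm /edot (bigD1 i)//= (bigD1 j)//= -addrA -expr2 lerDl.
apply: addr_ge0; first by apply: sumr_ge0 => k _; rewrite -expr2 sqr_ge0.
by apply: sumr_ge0 => l _; apply: sumr_ge0 => k _; rewrite -expr2 sqr_ge0.
Qed.

Lemma mx_reindex_continuous {m n : nat} (h : 'I_m -> 'I_n -> 'I_p * 'I_q) :
  continuous (fun x => \matrix_(i, j) x (h i j).1 (h i j).2 : 'M[R]_(m, n)).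
Proof.
move=> x s /= /nbhs_ballP [e e0 es].
apply/nbhs_ballP; exists e => //= y [_ xy]; apply: es.
by split=> // i j; rewrite !mxE; exact: xy.
Qed.

End euclid.

Lemma row_continuous {R : realType} {m n : nat} (i : 'I_m) :
  continuous (@row R m n i).
Proof. by have := mx_reindex_continuous (fun (_ : 'I_1) (j : 'I_n) => (i, j)). Qed.

Lemma mx_bounded_closed_compact {R : realType} {m n : nat}
    (A : set 'M[R]_(m, n)) :
  bounded_set A -> closed A -> compact A.
Proof.
have cv : continuous (@vec_mx R m n).
  have -> : @vec_mx R m n = fun v => \matrix_(i, j) v ord0 (mxvec_index i j).
    by apply/funext => v; apply/matrixP => i j; rewrite !mxE.
  exact: (mx_reindex_continuous (fun i j => (ord0, mxvec_index i j))).
move=> bA cA.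
have -> : A = @vec_mx R m n @` (@vec_mx R m n @^-1` A).
  apply/seteqP; split => [x Ax|_ [v Av <-]//].
  by exists (mxvec x); rewrite /= mxvecK.
apply: continuous_compact; first exact: continuous_subspaceT.
apply: bounded_closed_compact; last by apply: preimage_closed => // v _; exact: cv.
case: bA => M [Mr MA]; exists M; split=> // N MN v /= Av.
have N0 : 0 <= N by apply: le_trans (MA N MN _ Av).
rewrite {1}/Num.norm /= mx_normrE; apply/bigmax_leP; split=> // -[i j] _ /=.
rewrite ord1; case/mxvec_indexP: j => k l.
rewrite -[v]vec_mxK mxvecE; apply: le_trans (MA N MN _ Av).
rewrite [leRHS]/Num.norm /= mx_normrE.
by apply/bigmax_geP; right; exists (k, l).
Qed.

Definition strong_convexity {R : realType} {p q : nat} (mu : R)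
    (F : 'M[R]_(p, q) -> R) :=
  forall x y t, 0 < t -> t < 1 ->
    F (t *: x + (1 - t) *: y)
    <= t * F x + (1 - t) * F y - mu / 2 * (t * (1 - t)) * enorm (x - y) ^+ 2.

Lemma convex_setP (R : realType) (p q : nat) (D : set 'M[R]_(p, q)) :
  @convex_set R 'M[R]_(p, q) D -> forall x y t, D x -> D y -> 0 < t -> t < 1 ->
  D (t *: x + (1 - t) *: y).
Proof.
move=> cD x y t Dx Dy t0 t1.
have := cD x y (Itv01 (ltW t0) (ltW t1)); rewrite !inE; exact.
Qed.

Lemma strongly_convexP (R : realType) (n : nat) (sigma : R) (phi : 'rV[R]_n -> R) :
  strongly_convex sigma phi -> strong_convexity sigma phi.
Proof.
move=> cphi x y t t0 t1.
pose G z := phi z - sigma / 2 * enorm z ^+ 2.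
have : G (t *: x + (1 - t) *: y) <= t * G x + (1 - t) * G y.
  exact: (cphi (Itv01 (ltW t0) (ltW t1)) x y (in_setT _) (in_setT _)).
rewrite /G !sqr_enorm edotB edotDZl !edotDZ (edotC y x); lra.
Qed.

Section minimizer.
Context {R : realType} {p q : nat} {mu : R} {F : 'M[R]_(p, q) -> R}.
Context {D : set 'M[R]_(p, q)}.
Hypotheses (mu_gt0 : 0 < mu) (F_sc : strong_convexity mu F).
Hypothesis D_convex : @convex_set R 'M[R]_(p, q) D.

Lemma argmin_quadratic_growth x z : argmin D F x -> D z ->
  F x + mu / 2 * enorm (z - x) ^+ 2 <= F z.
Proof.
move=> [Dx Fx] Dz.
set b := mu / 2 * enorm (z - x) ^+ 2.
have b0 : 0 <= b by rewrite mulr_ge0 ?sqr_ge0// divr_ge0// ltW.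
have growth t : 0 < t -> t < 1 -> (1 - t) * b <= F z - F x.
  move=> t0 t1; rewrite -(ler_pM2l t0).
  have := Fx _ (convex_setP _ _ _ _ D_convex _ _ _ Dz Dx t0 t1).
  have := F_sc z x t t0 t1; rewrite /b; lra.
clearbody b; rewrite leNgt; apply/negP => lt.
set a := F z - F x in growth.
have ab : a < b by rewrite /a ltrBlDl.
have a0 : 0 <= a by rewrite /a subr_ge0 Fx.
have b_gt0 : 0 < b := le_lt_trans a0 ab.
have := growth ((b - a) / (2 * b)).
rewrite divr_gt0 ?subr_gt0 ?mulr_gt0// => /(_ isT).
rewrite ltr_pdivrMr ?mulr_gt0// => /(_ ltac:(lra)).
have -> : (1 - (b - a) / (2 * b)) * b = (b + a) / 2 by field; rewrite gt_eqF.
by lra.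
Qed.

Lemma argmin_uniq x z : argmin D F x -> argmin D F z -> x = z.
Proof.
move=> mx mz; have := argmin_quadratic_growth _ _ mx mz.1.
have := mz.2 _ mx.1 => Fzx Fxz; apply/esym/subr0_eq/enorm_eq0.
have [//|e0] := eqVneq (enorm (z - x)) 0.
have : 0 < mu / 2 * enorm (z - x) ^+ 2.
  by rewrite mulr_gt0 ?(divr_gt0 mu_gt0)// exprn_gt0// lt0r e0 enorm_ge0.
lra.
Qed.

Hypotheses (D_closed : closed D) (F_cont : continuous F).

(* Coercivity: along the segment from [x0] to a point [z] of the sublevel set at
   distance [d > 1], strong convexity at distance 1 reads
   [M <= F x0 - mu / 2 * (d - 1)], with [M] the minimum of [F] over the unit ball. *)
Lemma sublevel_compact x0 : D x0 -> compact (D `&` [set z | F z <= F x0]).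
Proof.
move=> Dx0; apply: mx_bounded_closed_compact; last first.
  apply: closedI => //; apply: (@preimage_closed _ _ F [set r | r <= F x0]).
    by move=> z _; exact: F_cont.
  exact: closed_le.
have cB : compact [set z | `|z - x0| <= 1].
  apply: mx_bounded_closed_compact.
    exists (1 + `|x0|); split; first exact: num_real.
    move=> N N1 z /= z1; apply/ltW/(le_lt_trans _ N1).
    by rewrite -[z in leLHS](subrK x0) (le_trans (ler_normD _ _))// lerD2r.
  have dist_cont : continuous (fun z : 'M[R]_(p, q) => `|z - x0|).
    move=> z; apply: (@continuous_comp _ _ _ (fun z : 'M[R]_(p, q) => z - x0) Num.norm).
      by apply: (@continuousB R _ _ id (fun=> x0) z);
        [exact: cvg_id|exact: cst_continuous].
    exact: norm_continuous.
  exact: (preimage_closed (fun z _ => dist_cont z) (@closed_le R 1)).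
have [|c _ minc] := compact_EVT_min _ cB (continuous_subspaceT F_cont).
  by exists x0; rewrite /= subrr normr0.
have {}minc z : `|z - x0| <= 1 -> F c <= F z.
  by move=> z1; apply: minc; rewrite inE.
pose M := 1 + 2 * (F x0 - F c) / mu + `|x0|.
exists M; split; first exact: num_real.
move=> N MN z [Dz Fz] /=; apply/ltW/(le_lt_trans _ MN).
rewrite -[z in leLHS](subrK x0) (le_trans (ler_normD _ _))// lerD2r.
have Fcx0 : 0 <= F x0 - F c by rewrite subr_ge0 minc// subrr normr0.
set d := `|z - x0|; have [d1|d1] := leP d 1.
  by rewrite (le_trans d1)// lerDl divr_ge0 ?mulr_ge0// ltW.
have d0 : 0 < d by lra.
have t0 : 0 < d^-1 by rewrite invr_gt0.
have t1 : d^-1 < 1 by rewrite invf_lt1.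
have := F_sc z x0 _ t0 t1.
set w := _ + _ => Fw.
have : F c <= F w.
  apply: minc.
  have -> : w - x0 = d^-1 *: (z - x0).
    by apply/matrixP => i j; rewrite !mxE; ring.
  by rewrite normrZ normfV normr_id mulVf// gt_eqF.
have dd : d ^+ 2 <= enorm (z - x0) ^+ 2.
  by rewrite ler_sqr ?nnegrE ?enorm_ge0 ?mx_norm_le_enorm// ltW.
have : mu / 2 * (d^-1 * (1 - d^-1)) * d ^+ 2 <=
       mu / 2 * (d^-1 * (1 - d^-1)) * enorm (z - x0) ^+ 2.
  by rewrite ler_wpM2l// !mulr_ge0 ?subr_ge0 ?ltW.
have -> : mu / 2 * (d^-1 * (1 - d^-1)) * d ^+ 2 = mu / 2 * (d - 1).
  by field; rewrite gt_eqF.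
have : d^-1 * F z <= d^-1 * F x0 by rewrite ler_pM2l.
move=> h1 h2 h3.
rewrite -lerBlDl ler_pdivlMr//; move: Fw; lra.
Qed.

Lemma argmin_exists : D !=set0 -> argmin D F !=set0.
Proof.
move=> [x0 Dx0].
have [|x /[!inE] -[Dx Fx] minx] :=
    compact_EVT_min _ (sublevel_compact _ Dx0) (continuous_subspaceT F_cont).
  by exists x0; split=> /=.
exists x; split=> // z Dz; have [Fz|/ltW Fz] := leP (F z) (F x0).
  by apply: minx; rewrite inE.
exact: le_trans Fz.
Qed.

End minimizer.

Section lagrangian.
Context {R : realType} {m n : nat}.
Implicit Types (x y : 'M[R]_(m, n)) (lam : 'M[R]_(m.-1, n)).

Lemma diff_opDZ (a b : R) x y :
  diff_op (a *: x + b *: y) = a *: diff_op x + b *: diff_op y.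
Proof. by apply/matrixP => i j; rewrite !mxE; ring. Qed.

Lemma sqr_enorm_rows x : enorm x ^+ 2 = \sum_i enorm (row i x) ^+ 2.
Proof.
rewrite sqr_enorm; apply: eq_bigr => i _.
by rewrite sqr_enorm /edot big_ord1; apply: eq_bigr => j _; rewrite !mxE.
Qed.

Lemma sqr_enorm_diff_op_le x : (0 < m)%N ->
  enorm (diff_op x) ^+ 2 <= (2 + 2 * cos (pi / m%:R)) * enorm x ^+ 2.
Proof.
rewrite !sqr_enorm /edot; case: m x => [//|k] x _ /=.
rewrite exchange_big /= [in leRHS]exchange_big mulr_sumr.
apply: ler_sum => j _.
set g := fun k => x (inord k) j.
have gE (i : 'I_k.+1) : g i = x i j by rewrite /g inord_val.
have dE (i : 'I_k) : @diff_op R k.+1 n x i j = g i - g i.+1.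
  by rewrite !mxE (gE (@fst_ord k.+1 i)) (gE (@snd_ord k.+1 i)).
have := path_diff_le R k g.
rewrite (eq_bigr (fun i : 'I_k => diff_op x i j * diff_op x i j)).
  by rewrite [in leRHS](eq_bigr (fun i => x i j * x i j))// => i _; rewrite gE.
by move=> i _; rewrite dE.
Qed.

Context {f : 'I_m -> 'rV[R]_n -> R}.

Lemma lagrangian_strong_convexity (mu : R) lam :
  (forall i, strong_convexity mu (f i)) ->
  strong_convexity mu (lagrangian f lam).
Proof.
move=> fsc x y t t0 t1; rewrite /lagrangian diff_opDZ edotDZ.
have : objective f (t *: x + (1 - t) *: y) <= t * objective f x
    + (1 - t) * objective f y - mu / 2 * (t * (1 - t)) * enorm (x - y) ^+ 2.
  rewrite /objective sqr_enorm_rows !mulr_sumr -big_split -sumrB.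
  apply: ler_sum => i _ /=.
  have -> : row i (t *: x + (1 - t) *: y) = t *: row i x + (1 - t) *: row i y.
    by apply/rowP => j; rewrite !mxE.
  have -> : row i (x - y) = row i x - row i y by apply/rowP => j; rewrite !mxE.
  exact: fsc.
lra.
Qed.

Lemma lagrangian_continuous lam :
  (forall i, continuous (f i)) -> continuous (lagrangian f lam).
Proof.
move=> fc.
have oc : continuous (objective f : 'M[R]_(m, n) -> R).
  apply: (continuous_big add_continuous) => i _ x.
  by apply: (@continuous_comp _ _ _ (row i) (f i));
    [exact: row_continuous|exact: fc].
have dc : continuous (fun x => edot lam (diff_op x)).
  apply: (continuous_big add_continuous) => i _.
  apply: (continuous_big add_continuous) => j _ x.
  have -> : (fun x => lam i j * diff_op x i j)
      = (fun x => lam i j * (x (fst_ord i) j - x (snd_ord i) j)).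
    by apply/funext => z; rewrite !mxE.
  apply: (@continuousM R 'M[R]_(m, n) (fun=> lam i j)
    (fun x => x (fst_ord i) j - x (snd_ord i) j) x).
    exact: cst_continuous.
  by apply: (@continuousB _ _ _ (fun x : 'M[R]_(m, n) => x (fst_ord i) j)
    (fun x => x (snd_ord i) j)); exact: coord_continuous.
by move=> x; exact: (continuousD (oc x) (dc x)).
Qed.

Lemma setpow_closed (Y : set 'rV[R]_n) :
  closed Y -> closed (setpow Y : set 'M[R]_(m, n)).
Proof.
move=> cY; have -> : setpow Y = \bigcap_i (@row R m n i @^-1` Y).
  by apply/seteqP; split => [x Yx i _|x Yx i]; [exact: Yx|exact: (Yx i)].
apply: closed_bigI => i _.
by apply: preimage_closed => // x _; exact: row_continuous.
Qed.

Lemma setpow_convex (Y : set 'rV[R]_n) :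
  @convex_set R 'rV[R]_n Y -> @convex_set R 'M[R]_(m, n) (setpow Y).
Proof.
move=> cY x y t; rewrite !inE => Yx Yy i; apply/set_mem.
have -> : row i (conv t (x : convex_lmodType 'M[R]_(m, n)) y)
    = conv t (row i x : convex_lmodType 'rV[R]_n) (row i y).
  by rewrite /conv/= linearD !linearZ.
by apply: cY; exact/mem_set.
Qed.

Lemma dual_function_argmin (Y : set 'rV[R]_n) lam x :
  argmin (setpow Y) (lagrangian f lam) x ->
  dual_function Y f lam = (lagrangian f lam x)%:E.
Proof.
move=> [Yx minx]; apply/eqP; rewrite eq_le; apply/andP; split.
  by apply: ereal_inf_lbound; exists x.
by apply: le_ereal_inf_tmp => _ [z Yz <-]; rewrite lee_fin minx.
Qed.

End lagrangian.

Theorem lemma8 (R : realType) (m n : nat) (hm : (2 <= m)%N) (hn : (1 <= n)%N)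
    (Y : set 'rV[R]_n) (Y_closed : closed Y)
    (Y_convex : @convex_set R 'rV[R]_n Y)
    (f : 'I_m -> 'rV[R]_n -> R)
    (f_strictly_convex : forall i, strictly_convex (f i))
    (f_closed : forall i, closed_function (f i))
    (mu_ : 'I_m -> R)
    (mu_gt0 : forall i, 0 < mu_ i)
    (f_strongly_convex : forall i, strongly_convex (mu_ i) (f i))
    (f_differentiable : forall i x, differentiable (f i) x)
    (ystar : 'M[R]_(m, n)) (ystar_optimal : primal_optimal Y f ystar)
    (lamstar : 'M[R]_(m.-1, n)) (lamstar_optimal : dual_optimal Y f lamstar)
    (strong_duality : (objective f ystar)%:E = dual_function Y f lamstar) :
  let mu : R := \big[Num.min/mu_ (Ordinal (ltnW hm))]_(i < m) mu_ i in
  let S : R := Num.sqrt ((4 + 4 * cos (pi / m%:R)) / mu) in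
  let g := dual_function Y f in
  let y := lagrangian_min Y f in
  forall lam : 'M[R]_(m.-1, n),
    [/\ argmin (setpow Y) (lagrangian f lam) = [set y lam],
        ((mu / 2 * enorm (y lam - ystar) ^+ 2)%:E <= g lamstar - g lam)%E
      & (`|objective f (y lam) - objective f ystar|%:E
         <= g lamstar - g lam
            + (S * enorm lam)%:E * sqrte (g lamstar - g lam))%E].
Proof.
move=> mu S g y lam; rewrite {}/g {}/y.
have m0 : (0 < m)%N := ltnW hm.
have mu0 : 0 < mu by apply: lt_bigmin.
have mu_le i : mu <= mu_ i by exact: bigmin_le.
have fsc i : strong_convexity mu (f i).
  move=> x z t t0 t1.
  apply: le_trans (strongly_convexP _ _ _ _ (f_strongly_convex i) x z t t0 t1) _.
  rewrite lerD2l lerN2; apply: ler_wpM2r; first exact: sqr_ge0.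
  by apply: ler_wpM2r; [rewrite mulr_ge0 ?subr_ge0 ?ltW | rewrite ler_pM2r].
have Lsc := lagrangian_strong_convexity mu lam fsc.
have fc i : continuous (f i).
  by move=> x; apply: differentiable_continuous; exact: f_differentiable.
have Ycv : @convex_set R 'M[R]_(m, n) (setpow Y) by exact: setpow_convex.
case: ystar_optimal => -[Yys /= Ays] _.
have Lys : lagrangian f lam ystar = objective f ystar.
  rewrite /lagrangian Ays [X in _ + X]big1 ?addr0// => i _.
  by rewrite big1// => j _; rewrite mxE mulr0.
have [x minx] : argmin (setpow Y) (lagrangian f lam) !=set0.
  apply: (argmin_exists mu0 Lsc) => //; last by exists ystar.
  - exact: setpow_closed.
  - exact: lagrangian_continuous.
have miny := xgetI 0 minx.
rewrite /lagrangian_min; set y := xget _ _ in miny *.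
have Dg : (dual_function Y f lamstar - dual_function Y f lam)%E
    = (objective f ystar - lagrangian f lam y)%:E.
  by rewrite -strong_duality (dual_function_argmin _ _ _ miny) EFinB.
rewrite {}Dg /=; set h := objective f ystar - _.
have yh : mu / 2 * enorm (y - ystar) ^+ 2 <= h.
  have := argmin_quadratic_growth mu0 Lsc Ycv _ _ miny Yys.
  rewrite Lys /h !sqr_enorm !edotB (edotC ystar y); lra.
have h0 : 0 <= h.
  by apply: le_trans yh; rewrite mulr_ge0 ?sqr_ge0// divr_ge0// ltW.
split.
- apply/seteqP; split => [z minz|_ ->//].
  exact: (argmin_uniq mu0 Lsc Ycv).
- by rewrite lee_fin.
rewrite -EFinM -EFinD lee_fin.
have -> : objective f y - objective f ystar = - (h + edot lam (diff_op y)).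
  by rewrite /h /lagrangian; ring.
rewrite normrN (le_trans (ler_normD _ _))// ger0_norm// lerD2l.
rewrite (le_trans (edot_le _ _))// [S * _]mulrC -mulrA ler_wpM2l ?enorm_ge0//.
have -> : diff_op y = diff_op (y - ystar).
  have -> : y - ystar = 1 *: y + (-1) *: ystar by rewrite scale1r scaleN1r.
  by rewrite diff_opDZ Ays scaler0 addr0 scale1r.
have c0 : 0 <= 2 + 2 * cos (pi / m%:R) :> R.
  by have := cos_geN1 (pi / m%:R : R); lra.
have S0 : 0 <= (4 + 4 * cos (pi / m%:R)) / mu.
  by rewrite divr_ge0 ?(ltW mu0)//; lra.
rewrite /S -sqrtrM// /enorm -[edot _ _]sqr_enorm ler_wsqrtr//.
apply: le_trans (sqr_enorm_diff_op_le _ m0) _.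
have -> : (4 + 4 * cos (pi / m%:R)) / mu * h
    = (2 + 2 * cos (pi / m%:R)) * (h / (mu / 2)) by field; rewrite gt_eqF.
by rewrite ler_wpM2l// ler_pdivlMr ?divr_gt0// mulrC.
Qed.
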